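(* Let $X, Y, Z$ be topological spaces and let $f : X \to Y$ and $g : Y \to Z$ be globally multi-split continuous functions. Then the composition $g \circ f : X \to Z$ is globally multi-split continuous.
   Context: A neighborhood of a point $p$ (respectively of a subset $S$) in a topological space is a set $V$, not necessarily open, for which there is an open set $U$ with $p \in U \subseteq V$ (respectively $S \subseteq U \subseteq V$). Let $f : X \to Y$ be a function between topological spaces and $p \in X$. The function $f$ is multi-split continuous at $p$ if there exists a finite non-empty set $Z_p \subseteq Y$ such that: (a) for every $y \in Z_p$ and all neighborhoods $U \subseteq X$ of $p$ and $V \subseteq Y$ of $y$ one has $f(U) \cap V \neq \varnothing$; (b) for every neighborhood $V \subseteq Y$ of the set $Z_p$ there exists a neighborhood $U \subseteq X$ of $p$ with $f(U) \subseteq V$. The function $f$ is globally multi-split continuous if it is multi-split continuous at every $p \in X$. *)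

(* Defs.v *)
From mathcomp Require Import all_boot.
From mathcomp Require Import all_classical.
From mathcomp Require Import topology.

Set Implicit Arguments.
Unset Strict Implicit.
Unset Printing Implicit Defensive.

Local Open Scope classical_set_scope.

(* Neighborhoods need not be open: [nbhs p V] holds iff V contains an open set
   containing p (nbhsE), and [set_nbhs S V] holds iff V contains an open set
   containing S (set_nbhsP). *)
Definition multi_split_continuous_at (X Y : topologicalType)
    (f : X -> Y) (p : X) : Prop :=
  exists S : set Y,
    [/\ finite_set S,
        S !=set0,
        forall y, S y -> forall (U : set X) (V : set Y),
          nbhs p U -> nbhs y V -> (f @` U) `&` V !=set0
      & forall V : set Y, set_nbhs S V ->
          exists2 U : set X, nbhs p U & f @` U `<=` V].

Definition globally_multi_split_continuous (X Y : topologicalType)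
    (f : X -> Y) : Prop :=
  forall p : X, multi_split_continuous_at f p.

(* Main.v *)
Require Import Defs.
From mathcomp Require Import all_boot.
From mathcomp Require Import all_classical.
From mathcomp Require Import topology.

(** Let [S] be the finite set attached to [f] at [p], and [T y] the one attached
to [g] at [y].  The union of the [T y] over [y] in [S] satisfies condition (b)
for [g \o f] at [p]: if [V] is a neighborhood of it, then the preimage of [V]
under [g] is a neighborhood of every [y] in [S], hence its preimage under [f] is
a neighborhood of [p].

Condition (a) may fail for that union: a point [z] of [T y] is approached by [g]
along points near [y], but these need not be values of [f] near [p].  The remedy
is to keep only the points of the union that satisfy (a), that is, the cluster
points of the image filter [g \o f @ p].  This loses nothing in (b): a discarded
point has a neighborhood missed by the function near [p], and as only finitely
many points are discarded, one neighborhood of [p] works for all of them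
([set_nbhs_cluster]).  What remains is non-empty, because otherwise (b) would
apply with the empty neighborhood.  So a finite set satisfying (b) alone already
witnesses multi-split continuity ([multi_split_continuous_at_finite]). *)

Local Open Scope classical_set_scope.

(** Each [z] in [S] has [A z] in [F] with [V `|` ~` A z] near [z]: the whole
space if [z] is a cluster point, and otherwise a set separated from [z].  As [S]
is finite, the intersection [I] of the [A z] is in [F]; then [V `|` ~` I] is a
neighborhood of [S], so it is in [F], and meeting it with [I] leaves a part
of [V]. *)
Lemma set_nbhs_cluster (Y : topologicalType) (F : set (set Y)) (S : set Y) :
  Filter F -> finite_set S ->
  (forall V, set_nbhs S V -> F V) ->
  forall V, set_nbhs (S `&` cluster F) V -> F V.
Proof.
move=> FF finS SF V SV.
have /choice[A hA] z : exists A, S z -> F A /\ nbhs z (V `|` ~` A).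
  have [Sz|nSz] := pselect (S z); last by exists setT.
  have [Fz|/existsNP[A /existsNP[B nAB]]] := pselect (cluster F z).
    exists setT => _; split; first exact: filterT.
    by apply: filterS (SV z _) => // y; left.
  have [FA /not_implyP[zB AB0]] := (iffLR (not_implyP _ _)) nAB.
  exists A => _; split=> //; apply: filterS zB => y By.
  by right => Ay; apply: AB0; exists y.
pose I := \bigcap_(z in S) A z.
have FI : F I.
  have [D SD] := (iffLR finite_fsetP) finS.
  rewrite /I SD; apply: filter_bigI => z zD.
  by have [] : F (A z) /\ nbhs z (V `|` ~` A z) by apply: hA; rewrite SD.
have FVI : F (V `|` ~` I).
  apply: SF => z Sz; have [_] := hA z Sz.
  by apply: filterS => y [Vy|nAy]; [left|right=> Iy; apply/nAy/Iy].
by apply: filterS2 FI FVI => y Iy [].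
Qed.

(** The witness is the set of cluster points of [f @ p] in [S]; clustering is
condition (a), and (b) with [V = set0] forces this set to be non-empty. *)
Lemma multi_split_continuous_at_finite (X Y : topologicalType) (f : X -> Y)
    (p : X) (S : set Y) :
  finite_set S -> (forall V, set_nbhs S V -> nbhs p (f @^-1` V)) ->
  multi_split_continuous_at f p.
Proof.
move=> finS Sf; have trim := set_nbhs_cluster _ (f @ p) S _ finS Sf.
exists (S `&` cluster (f @ p)); split.
- exact: finite_setIl.
- apply/set0P/eqP => S0.
  have /nbhs_singleton // : nbhs p (f @^-1` set0).
  by apply: trim; rewrite S0 => z.
- move=> z [_ fz] U V pU zV; apply: fz => //.
  by apply: filterS pU => x Ux; exists x.
- by move=> V /trim pV; exists (f @^-1` V) => // _ [x Vx <-].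
Qed.

Theorem theorem3p7 (X Y Z : topologicalType) (f : X -> Y) (g : Y -> Z)
    (hf : globally_multi_split_continuous f)
    (hg : globally_multi_split_continuous g) :
  globally_multi_split_continuous (g \o f).
Proof.
move=> p; have [S [finS _ _ Sf]] := hf p.
have /choice[T hT] := hg.
apply: (multi_split_continuous_at_finite _ _ _ _ (\bigcup_(y in S) T y)).
  by apply: bigcup_finite => // y _; have [] := hT y.
move=> V TV.
have SgV : set_nbhs S (g @^-1` V).
  move=> y Sy; have [_ _ _ Tg] := hT y.
  have [|U yU gUV] := Tg V; first by move=> z Tz; apply: TV; exists y.
  by apply: filterS yU => u Uu; apply: gUV; exists u.
have [U pU fUV] := Sf _ SgV.
by apply: filterS pU => x Ux; apply: (fUV (f x)); exists x.
Qed.
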